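(* Let $p \in \mathbb{N}$, let $\mathbf{X} = (X_1,\dots,X_p)$ be an $\mathbb{R}^p$-valued random vector and let $Y \in L^2$ be a non-degenerate real-valued random variable on a common probability space. Let $(Y,Y')$ be the Markov product of $(\mathbf{X},Y)$, i.e. $Y'$ is a conditionally independent copy of $Y$ given $\mathbf{X}$. Then the following statements are equivalent: (a) $R^2(Y|\mathbf{X}) = 0$. (b) $Y$ is not explainable through $\mathbf{X}$, i.e. $\mathbb{E}(Y|\mathbf{X}) = \mathbb{E}(Y)$ almost surely. (c) $Y$ and $Y'$ are uncorrelated.
   Context: Markov product: $Y'$ is a random variable such that, for $\mathbb{P}^{\mathbf{X}}$-almost all $\mathbf{x} \in \mathbb{R}^p$, the conditional distribution of $Y'$ given $\mathbf{X}=\mathbf{x}$ equals the conditional distribution of $Y$ given $\mathbf{X}=\mathbf{x}$, and $Y$ and $Y'$ are conditionally independent given $\mathbf{X}$. The pair $(Y,Y')$ is called the Markov product of $(\mathbf{X},Y)$. Pearson's correlation ratio: for $Y \in L^2$ non-degenerate (i.e. not almost surely constant), $$R^2(Y|\mathbf{X}) := \frac{\operatorname{Var}(\mathbb{E}(Y|\mathbf{X}))}{\operatorname{Var}(Y)}.$$ Here $\mathbb{P}^Z$ denotes the distribution of a random variable or vector $Z$. *)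

(* Defs.v *)
From HB Require Import structures.
From mathcomp Require Import all_boot all_order all_algebra.
From mathcomp Require Import all_classical all_reals all_analysis measurable_realfun.

Set Implicit Arguments.
Unset Strict Implicit.
Unset Printing Implicit Defensive.

Import Order.TTheory GRing.Theory Num.Theory.
Import numFieldNormedType.Exports.

Local Open Scope classical_set_scope.
Local Open Scope ring_scope.
Local Open Scope ereal_scope.

Section conditional_expectation.
Context d d' (T : measurableType d) (S : measurableType d') (R : realType).
Variables (P : probability T R) (X : {RV P >-> S}).

(* [Z] is a version of E(Y | X): sigma(X)-measurable, integrable, with the same
   integral as [Y] over every event of sigma(X). *)
Definition is_cond_expectation (Y Z : T -> R) : Prop :=
  [/\ @measurable_fun _ _ (g_sigma_algebra_preimageType X) R setT Z,
      P.-integrable setT (EFin \o Z)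
    & forall A, g_sigma_algebra_preimage X A ->
        \int[P]_(w in A) (Z w)%:E = \int[P]_(w in A) (Y w)%:E].

(* A version of E(Y | X). It is meaningful for integrable [Y], for which a
   version exists ([cond_expectationP]) and is unique up to a null set
   ([cond_expectation_unique]). *)
Definition cond_expectation (Y : T -> R) : T -> R :=
  xget (cst 0%R) [set Z | is_cond_expectation Y Z].

Lemma cond_expectationP (Y : T -> R) : P.-integrable setT (EFin \o Y) ->
  is_cond_expectation Y (cond_expectation Y).
Proof.
move=> iY; rewrite /cond_expectation; case: xgetP => //.
suff [Z hZ] : exists Z, is_cond_expectation Y Z by move=> /(_ Z).
have mX : measurable_fun [set: T] X by exact: measurable_funPT.
pose nu : {charge set S -> \bar R} :=
  measure_function_pushforward__canonical__charge_Charge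
    (induced_charge iY) mX.
pose mu : probability S R := distribution P X.
have numu : nu `<< mu.
  apply/null_content_dominatesP => A mA muA.
  rewrite /nu /= /pushforward /induced_charge.
  apply: null_set_integral => //; first exact: measurable_funPTI.
  have mY := measurable_int P iY.
  exact: (measurable_funS measurableT _ mY).
pose f := Radon_Nikodym nu mu.
have ffin x : f x \is a fin_num by exact: Radon_Nikodym_fin_num.
have fi : mu.-integrable setT f by exact: Radon_Nikodym_integrable.
have mf := measurable_int mu fi.
have EfX : EFin \o (fine \o f \o X) = f \o X.
  by apply/funext => w /=; rewrite fineK.
have ifX : P.-integrable setT (f \o X).
  apply/integrableP; split; first exact: measurableT_comp.
  have /integrableP[_] := fi.
  rewrite ge0_integral_pushforward//; exact: measurableT_comp.
exists (fine \o f \o X); split.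
- move=> _ B mB; exists ((fine \o f) @^-1` B) => //.
  have mff : measurable_fun setT (fine \o f) by exact: measurableT_comp.
  by rewrite -[X in measurable X]setTI; exact: mff.
- by rewrite EfX.
- move=> A [B mB <-{A}]; rewrite setTI.
  have -> : \int[P]_(w in X @^-1` B) ((fine \o f \o X) w)%:E =
            \int[P]_(w in X @^-1` B) (f \o X) w.
    by apply: eq_integral => w _ /=; rewrite fineK.
  have mXB : measurable (X @^-1` B) by exact: measurable_funPTI.
  have iB : P.-integrable (X @^-1` B) (f \o X).
    exact: (integrableS measurableT).
  rewrite -(integral_pushforward mX mf iB mB).
  by rewrite -/mu -(Radon_Nikodym_integral numu mB).
Qed.

Lemma cond_expectation_unique (Y Z1 Z2 : T -> R) :
  is_cond_expectation Y Z1 -> is_cond_expectation Y Z2 ->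
  {ae P, forall w, Z1 w = Z2 w}.
Proof.
move=> [mZ1 iZ1 Z1E] [mZ2 iZ2 Z2E].
pose G := g_sigma_algebra_preimageType X.
pose phi : T -> G := fun w => w.
have mphi : measurable_fun setT phi.
  move=> _ B [C mC <-]; rewrite setTI /phi preimage_id setTI.
  exact: measurable_funPTI.
pose phim : {mfun T >-> G} := HB.pack phi (isMeasurableFun.Build _ _ _ _ phi mphi).
pose mu : probability G R := distribution P phim.
have mE (Z : T -> R) : @measurable_fun _ _ G R setT Z ->
    measurable_fun [set: G] (EFin \o Z : G -> \bar R).
  by move=> mZ; exact/measurable_EFinP.
have iE (Z : T -> R) : @measurable_fun _ _ G R setT Z ->
    P.-integrable setT (EFin \o Z) -> mu.-integrable [set: G] (EFin \o Z).
  move=> mZ /integrableP[_ fZ]; apply/integrableP; split; first exact: mE.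
  rewrite ge0_integral_pushforward//.
  by apply: measurableT_comp => //; exact: mE.
have intE (Z : T -> R) (A : set G) : @measurable_fun _ _ G R setT Z ->
    P.-integrable setT (EFin \o Z) -> measurable A ->
    \int[mu]_(w in A) (EFin \o Z) w = \int[P]_(w in A) (Z w)%:E.
  move=> mZ iZ mA; rewrite (integral_pushforward mphi)//; first exact: mE.
  apply: (integrableS measurableT) => //.
  by rewrite -[X in measurable X]setTI; apply mphi.
have : ae_eq mu [set: G] (EFin \o Z1) (EFin \o Z2).
  apply: integral_ae_eq => //; [exact: iE|exact: mE|move=> A _ mA].
  by rewrite !intE// Z1E// Z2E.
move=> [N [mN N0 hN]]; exists N; split => //.
  by move: mN => [C mC <-]; rewrite setTI; exact: measurable_funPTI.
apply: subset_trans hN => w /= h1 h2; apply: h1.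
by have := h2 I => -[].
Qed.

Definition cond_probability (A : set T) : T -> R := cond_expectation \1_A.

End conditional_expectation.

Section markov_product.
Context d d' (T : measurableType d) (S : measurableType d') (R : realType).
Variables (P : probability T R) (X : {RV P >-> S}).

(* [k x] is the conditional distribution of [Y] given [X = x]. *)
Definition is_cond_distribution (Y : {RV P >-> R}) (k : R.-pker S ~> R) : Prop :=
  forall A B, measurable A -> measurable B ->
    P (X @^-1` A `&` Y @^-1` B) = \int[distribution P X]_(x in A) k x B.

(* Some (equivalently, any) versions of the two conditional distributions agree
   almost everywhere: versions exist, as [R] is a standard Borel space, and two
   of them agree outside a null set of [distribution P X]. *)
Definition same_cond_distribution (Y Y' : {RV P >-> R}) : Prop :=
  exists k k' : R.-pker S ~> R,
    [/\ is_cond_distribution Y k, is_cond_distribution Y' k'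
      & {ae distribution P X,
           forall x, forall B, measurable B -> k x B = k' x B}].

Definition cond_independent (Y Y' : {RV P >-> R}) : Prop :=
  forall B B', measurable B -> measurable B' ->
    {ae P, forall w, cond_probability X (Y @^-1` B `&` Y' @^-1` B') w =
       (cond_probability X (Y @^-1` B) w * cond_probability X (Y' @^-1` B') w)%R}.

Definition markov_product (Y Y' : {RV P >-> R}) : Prop :=
  same_cond_distribution Y Y' /\ cond_independent Y Y'.

(* Extended-real valued because ['V_P] is; both variances are finite real numbers
   when [Y] is in L^2. *)
Definition correlation_ratio (Y : T -> R) : \bar R :=
  'V_P[cond_expectation X Y] / 'V_P[Y].

End markov_product.

Section random_variable_predicates.
Context d (T : measurableType d) (R : realType) (P : probability T R).

Definition degenerate (Y : T -> R) : Prop :=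
  exists c : R, {ae P, forall w, Y w = c}.

Definition uncorrelated (Y Y' : T -> R) : Prop := covariance P Y Y' = 0.

End random_variable_predicates.

(* Main.v *)
Require Import Defs.
From HB Require Import structures.
From mathcomp Require Import all_boot all_order all_algebra.
From mathcomp Require Import all_classical all_reals all_analysis.
From mathcomp Require Import measurable_realfun giry.

Set Implicit Arguments.
Unset Strict Implicit.
Unset Printing Implicit Defensive.

Import Order.TTheory GRing.Theory Num.Theory.

(** The heart of the matter is the identity Cov(Y, Y') = Var(E(Y|X))
    ([covariance_cond_copy]). Heuristically, by conditional independence and
    equality of the conditional laws,
    E(Y Y') = E(E(Y|X) E(Y'|X)) = E(E(Y|X)^2), while Y, Y' and E(Y|X) have the
    same mean. Granted this identity, (a) and (c) both say that the variance of
    E(Y|X) vanishes, that is, that E(Y|X) is almost surely equal to its mean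
    E(Y), which is (b).

    The heuristic has to be derived from a conditional independence that only
    speaks of events. Let k be a conditional distribution of both Y and Y'
    given X. Averaging the conditional independence over X gives
    P(Y in B, Y' in B') = E(k(X, B) k(X, B')): on rectangles, the law of (Y, Y')
    is the mixture over X of the product measures k(X) x k(X). Finite measures
    that agree on rectangles are equal, so integrals against the two agree, and
    the Fubini-Tonelli theorem inside the mixture gives
    E(f(Y) g(Y')) = E(int f dk(X) * int g dk(X)) for all measurable f, g >= 0
    ([ge0_expectation_product_mixture]). Applied to (X, Y), whose law is the
    mixture of the products dirac(X) x k(X), the same lemma shows that
    int f dk(X) is a version of E(f(Y)|X) ([is_cond_expectation_kmean]).

    Hence Cov(f(Y), g(Y')) is the covariance of versions of E(f(Y)|X) and
    E(g(Y)|X) for nonnegative f and g, and bilinearity of the covariance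
    extends this to Y, the difference of its positive and negative parts. *)

Local Open Scope classical_set_scope.
Local Open Scope ring_scope.
Local Open Scope ereal_scope.

(** * Mixtures of product measures *)

(** Rectangles form a pi-system that generates the product sigma-algebra. *)
Lemma finite_measure_eq_rectangles d1 d2 (S1 : measurableType d1)
    (S2 : measurableType d2) (R : realType)
    (m1 m2 : {finite_measure set (S1 * S2)%type -> \bar R}) :
  (forall A B, measurable A -> measurable B -> m1 (A `*` B) = m2 (A `*` B)) ->
  forall C, measurable C -> m1 C = m2 C.
Proof.
move=> rect C mC.
pose G : set (set (S1 * S2)%type) :=
  [set A `*` B | A in measurable & B in measurable].
apply: (measure_unique G (fun=> setT)) => //.
- by rewrite measurable_prod_measurableType.
- move=> _ _ [A1 mA1 [B1 mB1 <-]] [A2 mA2 [B2 mB2 <-]].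
  exists (A1 `&` A2); first exact: measurableI.
  by exists (B1 `&` B2); [exact: measurableI|rewrite setXI].
- by move=> _; exists setT => //; exists setT => //; rewrite setXTT.
- by rewrite bigcup_const//; exists 0%N.
- by move=> _ [A mA [B mB <-]]; exact: rect.
- by move=> _; rewrite ltey_eq fin_num_measure.
Qed.

(** The law of (U, V) and the mixture of the products of k1 and k2 are both
    measures on the product space that agree on rectangles, hence everywhere.
    The right-hand side is the integral of f x g against the mixture, computed
    by the Fubini-Tonelli theorem in each component. The mixture is built as a
    bind of the Giry monad, which supplies its measurability and its
    integrals. *)
Lemma ge0_expectation_product_mixture d d1 d2 (T : measurableType d)
    (S1 : measurableType d1) (S2 : measurableType d2) (R : realType)
    (P : probability T R) (U : T -> S1) (V : T -> S2)
    (k1 : T -> giry S1 R) (k2 : T -> giry S2 R) :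
  measurable_fun setT U -> measurable_fun setT V ->
  measurable_fun setT k1 -> measurable_fun setT k2 ->
  (forall A B, measurable A -> measurable B ->
    P (U @^-1` A `&` V @^-1` B) = \int[P]_w (k1 w A * k2 w B)) ->
  forall (f : S1 -> \bar R) (g : S2 -> \bar R),
  measurable_fun setT f -> measurable_fun setT g ->
  (forall x, 0 <= f x) -> (forall y, 0 <= g y) ->
  \int[P]_w (f (U w) * g (V w)) =
  \int[P]_w ((\int[k1 w]_x f x) * (\int[k2 w]_y g y)).
Proof.
move=> mU mV mk1 mk2 rect f g mf mg f0 g0.
have mUV : measurable_fun setT (fun w => (U w, V w)).
  exact: measurable_fun_pair.
have mk : measurable_fun setT (fun w => giry_prod (k1 w, k2 w)).
  apply: (measurableT_comp measurable_giry_prod).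
  exact: measurable_fun_pair.
pose law : giry (S1 * S2)%type R := giry_map mUV (P : giry T R).
pose mix : giry (S1 * S2)%type R := giry_bind (P : giry T R) mk.
have law_mix C : measurable C -> law C = mix C.
  apply: finite_measure_eq_rectangles => A B mA mB.
  rewrite /law/= /pushforward/= [LHS](rect A B)//.
  rewrite /mix /giry_bind/= giry_int_map//.
    by apply: eq_integral => w _ /=; rewrite /giry_ev /= product_measure1E.
  exact: measurable_giry_ev (measurableX mA mB).
pose h z := f z.1 * g z.2.
have mh : measurable_fun setT h.
  by apply: emeasurable_funM; apply: measurableT_comp.
have h0 z : 0 <= h z by exact: mule_ge0.
transitivity (giry_int law h); first by rewrite giry_int_map.
transitivity (giry_int mix h).
  by apply: eq_measure_integral => A mA _; exact: law_mix.
rewrite giry_int_bind//; apply: eq_integral => w _.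
rewrite giry_int_prod1// /giry_int /h/=.
transitivity (\int[k1 w]_x (f x * \int[k2 w]_y g y)).
  by apply: eq_integral => x _; rewrite ge0_integralZl.
by rewrite ge0_integralZr// integral_ge0.
Qed.

(** * Conditional distributions and conditional means *)

Section pker_giry.
Context d d' (S : measurableType d) (T : measurableType d') (R : realType).
Variable k : R.-pker S ~> T.

Let kmeas (x : S) : set T -> \bar R := k x.

HB.instance Definition _ x := Measure.on (kmeas x).

Let kmeas_setT x : kmeas x setT <= 1.
Proof. by rewrite /kmeas prob_kernel. Qed.

HB.instance Definition _ x :=
  Measure_isSubProbability.Build _ _ _ (kmeas x) (kmeas_setT x).

(** The values of a probability kernel, bundled as points of the Giry monad,
    whose elements are subprobability measures. *)
Definition pker_giry (x : S) : giry T R := kmeas x.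

Lemma measurable_pker_giry : measurable_fun setT pker_giry.
Proof.
by apply: measurable_giry_codensity => // B mB; exact: measurable_kernel.
Qed.

End pker_giry.

Section conditional_mean.
Context d d' (T : measurableType d) (S : measurableType d') (R : realType).
Variables (P : probability T R) (X : {RV P >-> S}).

(** The law of (X, Y) is the mixture of the products of the Dirac measure at X
    and of k(X), so the mixture formula applies to the product of the indicator
    of B and of g. *)
Lemma integral_cond_distribution (Y : {RV P >-> R}) (k : R.-pker S ~> R)
    (g : R -> \bar R) (B : set S) :
  is_cond_distribution X Y k -> measurable B ->
  measurable_fun setT g -> (forall y, 0 <= g y) ->
  \int[P]_(w in X @^-1` B) g (Y w) =
  \int[P]_(w in X @^-1` B) \int[k (X w)]_y g y.
Proof.
move=> kY mB mg g0.
have restrE (F : T -> \bar R) w :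
    (F \_ (X @^-1` B)) w = (\1_B (X w))%:E * F w.
  rewrite patchE indicE -[w \in _]/(X w \in B).
  by case: (X w \in B); rewrite ?mul1e ?mul0e.
rewrite integral_mkcond [RHS]integral_mkcond.
under eq_integral do rewrite restrE.
under [RHS]eq_integral do rewrite restrE.
rewrite (@ge0_expectation_product_mixture _ _ _ _ _ _ _ P X Y
  (@giry_ret _ S R \o X) (pker_giry k \o X) _ _ _ _ _ (EFin \o \1_B))//.
- apply: eq_integral => w _ /=; rewrite integral_dirac//.
    by rewrite diracT mul1e.
  exact/measurable_EFinP/measurable_indic.
- by apply: measurableT_comp => //; exact: measurable_giry_ret.
- by apply: measurableT_comp => //; exact: measurable_pker_giry.
- move=> A C mA mC; rewrite kY// integral_mkcond/= ge0_integral_pushforward//.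
  + apply: eq_integral => w _ /=; rewrite patchE diracE.
    by case: ifPn => _; rewrite ?mul1e ?mul0e.
  + apply/(measurable_restrictT _ _).1 => //.
    exact/measurable_funTS/measurable_kernel.
  + by move=> x; apply: erestrict_ge0.
- exact/measurable_EFinP/measurable_indic.
- by move=> x; rewrite lee_fin.
Qed.

(** The mean of f(Y) given X = x, when k is the conditional distribution of Y.
    For integrable f(Y) the integral is finite for almost all values of X;
    [fine] sets it to 0 for the others, so that versions of E(f(Y)|X) are
    real-valued. *)
Definition kmean (k : R.-pker S ~> R) (f : R -> R) (x : S) : R :=
  fine (\int[k x]_y (f y)%:E).

Lemma measurable_kernel_integral (k : R.-pker S ~> R) (f : R -> R) :
  measurable_fun setT f -> (forall y, 0 <= f y)%R ->
  measurable_fun setT (fun x => \int[k x]_y (f y)%:E).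
Proof.
move=> mf f0; apply: measurable_fun_integral_kernel => //.
  by move=> U mU; exact: measurable_kernel.
exact/measurable_EFinP.
Qed.

Lemma measurable_kmean (k : R.-pker S ~> R) (f : R -> R) :
  measurable_fun setT f -> (forall y, 0 <= f y)%R ->
  measurable_fun setT (kmean k f).
Proof.
move=> mf f0; apply: measurableT_comp => //.
exact: measurable_kernel_integral.
Qed.

(** The mean of the conditional integral is E(f(Y)), which is finite. *)
Lemma EFin_kmean_ae (Y : {RV P >-> R}) (k : R.-pker S ~> R) (f : R -> R) :
  is_cond_distribution X Y k ->
  measurable_fun setT f -> (forall y, 0 <= f y)%R ->
  P.-integrable setT (EFin \o (f \o Y)) ->
  {ae P, forall w, (kmean k f (X w))%:E = \int[k (X w)]_y (f y)%:E}.
Proof.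
move=> kY mf f0 ifY.
have : P.-integrable setT (fun w => \int[k (X w)]_y (f y)%:E).
  apply/integrableP; split.
    exact: (measurableT_comp (measurable_kernel_integral k mf f0)).
  have /integrableP[_] := ifY; apply: le_lt_trans.
  rewrite le_eqVlt; apply/orP; left; apply/eqP.
  transitivity (\int[P]_w \int[k (X w)]_y (f y)%:E).
    apply: eq_integral => w _; rewrite gee0_abs// integral_ge0// => y _.
    by rewrite lee_fin.
  have := integral_cond_distribution kY measurableT (_ : _ _ (EFin \o f)).
  rewrite preimage_setT => <-//; last exact/measurable_EFinP.
  by apply: eq_integral => w _ /=; rewrite ger0_norm.
move=> /integrable_ae -/(_ measurableT).
by apply: filterS => w /(_ I) fin; rewrite fineK.
Qed.

(** This connects kernels with the conditional expectation defined through the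
    sigma-algebra of X: every event of that sigma-algebra is the preimage of
    some B, over which [integral_cond_distribution] applies. *)
Lemma is_cond_expectation_kmean (Y : {RV P >-> R}) (k : R.-pker S ~> R)
    (f : R -> R) :
  is_cond_distribution X Y k ->
  measurable_fun setT f -> (forall y, 0 <= f y)%R ->
  P.-integrable setT (EFin \o (f \o Y)) ->
  is_cond_expectation X (f \o Y) (kmean k f \o X).
Proof.
move=> kY mf f0 ifY.
have aeE := EFin_kmean_ae kY mf f0 ifY.
have mkX : measurable_fun setT (kmean k f \o X).
  by apply: measurableT_comp => //; exact: measurable_kmean.
have kX0 w : (0 <= kmean k f (X w))%R.
  by rewrite fine_ge0// integral_ge0// => y _; rewrite lee_fin.
have mIX : measurable_fun setT (fun w => \int[k (X w)]_y (f y)%:E).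
  exact: (measurableT_comp (measurable_kernel_integral k mf f0)).
have E B : measurable B ->
    \int[P]_(w in X @^-1` B) (kmean k f (X w))%:E =
    \int[P]_(w in X @^-1` B) (f (Y w))%:E.
  move=> mB.
  have mXB : measurable (X @^-1` B) by exact: measurable_funPTI.
  transitivity (\int[P]_(w in X @^-1` B) \int[k (X w)]_y (f y)%:E).
    apply: ge0_ae_eq_integral => //.
    - exact/measurable_EFinP/measurable_funTS.
    - exact: measurable_funTS.
    - by move=> w _; rewrite lee_fin.
    - by move=> w _; apply: integral_ge0 => y _; rewrite lee_fin.
    - by apply: filterS aeE => w /= ->.
  by rewrite -(integral_cond_distribution kY)//; exact/measurable_EFinP.
split.
- move=> _ B mB; exists (kmean k f @^-1` B) => //.
  rewrite -[X in measurable X]setTI; exact: measurable_kmean.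
- apply/integrableP; split; first exact/measurable_EFinP.
  have := E setT measurableT; rewrite preimage_setT => ET.
  have /integrableP[_] := ifY.
  under eq_integral do rewrite /= ger0_norm//.
  under [X in _ -> X < _]eq_integral do rewrite /= ger0_norm//.
  by rewrite ET.
- by move=> A [B mB <-{A}]; rewrite setTI E.
Qed.

(** The conditional probabilities of the two events are k(X, B) and k'(X, B')
    by uniqueness of the conditional expectation of an indicator; integrating
    the conditional independence over the whole space concludes. *)
Lemma cond_independent_product (Y Y' : {RV P >-> R}) (k k' : R.-pker S ~> R)
    (B B' : set R) :
  is_cond_distribution X Y k -> is_cond_distribution X Y' k' ->
  cond_independent X Y Y' -> measurable B -> measurable B' ->
  P (Y @^-1` B `&` Y' @^-1` B') = \int[P]_w (k (X w) B * k' (X w) B').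
Proof.
move=> kY kY' YY' mB mB'.
have mYB : measurable (Y @^-1` B) by exact: measurable_funPTI.
have mYB' : measurable (Y' @^-1` B') by exact: measurable_funPTI.
have mI : measurable (Y @^-1` B `&` Y' @^-1` B') by exact: measurableI.
have iind A : measurable A -> P.-integrable setT (EFin \o (\1_A : T -> R)).
  by move=> mA; exact: integrable_indic.
have cpE (Z : {RV P >-> R}) (l : R.-pker S ~> R) C :
    is_cond_distribution X Z l -> measurable C ->
    {ae P, forall w, (cond_probability X (Z @^-1` C) w)%:E = l (X w) C}.
  move=> lZ mC.
  have mZC : measurable (Z @^-1` C) by exact: measurable_funPTI.
  have ZE := cond_expectationP X (iind _ mZC).
  have i1 : P.-integrable setT (EFin \o (\1_C \o Z)) by exact: iind.
  have lE : is_cond_expectation X \1_(Z @^-1` C) (kmean l \1_C \o X).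
    exact: is_cond_expectation_kmean.
  have := cond_expectation_unique ZE lE.
  apply: filterS2 (EFin_kmean_ae lZ _ _ i1) => //= w kE cE.
  rewrite /cond_probability cE.
  by rewrite kE integral_indic// setIT.
have [mW iW WE] := cond_expectationP X (iind _ mI).
have gT : g_sigma_algebra_preimage X setT.
  by exists setT => //; rewrite preimage_setT setTI.
have := WE setT gT; rewrite integral_indic// setIT => <-.
apply: ae_eq_integral => //.
- exact: measurable_int iW.
- by apply: emeasurable_funM;
    apply: (measurableT_comp (measurable_kernel _ _ _)).
have := YY' _ _ mB mB'.
apply: filterS3 (cpE _ _ _ kY mB) (cpE _ _ _ kY' mB') => w h1 h2 h3 _ /=.
by rewrite -/(cond_probability _ _ _) h3 EFinM h1 h2.
Qed.

(** Two kernels that agree for almost all values of X are conditional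
    distributions of the same variables, so that one kernel serves for both Y
    and Y'. *)
Lemma markov_product_kernel (Y Y' : {RV P >-> R}) : markov_product X Y Y' ->
  exists k : R.-pker S ~> R,
    is_cond_distribution X Y k /\ is_cond_distribution X Y' k.
Proof.
move=> [[k [k' [kY kY' kk']]] _]; exists k; split=> // A B mA mB.
rewrite kY'//; apply: ge0_ae_eq_integral => //.
- exact/measurable_funTS/measurable_kernel.
- exact/measurable_funTS/measurable_kernel.
- by apply: filterS kk' => x kk'x _; rewrite kk'x.
Qed.

Lemma ge0_expectation_cond_independent (Y Y' : {RV P >-> R})
    (k k' : R.-pker S ~> R) (f g : R -> \bar R) :
  is_cond_distribution X Y k -> is_cond_distribution X Y' k' ->
  cond_independent X Y Y' ->
  measurable_fun setT f -> measurable_fun setT g ->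
  (forall x, 0 <= f x) -> (forall y, 0 <= g y) ->
  \int[P]_w (f (Y w) * g (Y' w)) =
  \int[P]_w ((\int[k (X w)]_x f x) * (\int[k' (X w)]_y g y)).
Proof.
move=> kY kY' YY' mf mg f0 g0.
apply: (@ge0_expectation_product_mixture _ _ _ _ _ _ _ P Y Y'
  (pker_giry k \o X) (pker_giry k' \o X)) => //.
- by apply: measurableT_comp => //; exact: measurable_pker_giry.
- by apply: measurableT_comp => //; exact: measurable_pker_giry.
- by move=> A B mA mB; exact: cond_independent_product.
Qed.

End conditional_mean.

(** * Square-integrable functions and variance *)

Section square_integrable.
Context d (T : measurableType d) (R : realType) (P : probability T R).

Lemma Lfun2_sqr (f : T -> R) : measurable_fun setT f ->
  \int[P]_w ((f w) ^+ 2)%:E < +oo -> f \in Lfun P 2%:E.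
Proof.
move=> mf fy; rewrite inE; apply/andP; split; rewrite inE//=.
rewrite /finite_norm unlock/= poweR_lty//.
under eq_integral do rewrite powR_mulrn// -normrX ger0_norm ?sqr_ge0//.
exact: fy.
Qed.

Lemma Lfun2_le (f g : T -> R) : measurable_fun setT f ->
  (forall w, `|f w| <= `|g w|)%R -> g \in Lfun P 2%:E -> f \in Lfun P 2%:E.
Proof.
move=> mf fg g2; apply: Lfun2_sqr => //.
have ig := Lfun2_integrable_sqr g2.
apply: le_lt_trans (integrable_lty measurableT ig).
apply: ge0_le_integral => //.
- by move=> w _; rewrite lee_fin sqr_ge0.
- by apply/measurable_EFinP; exact: measurable_funX.
- exact: measurable_int ig.
- move=> w _; rewrite lee_fin -(real_normK (num_real (f w))).
  by rewrite -(real_normK (num_real (g w))) lerXn2r ?nnegrE.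
Qed.

Lemma ae_eq_expectation (U V : T -> R) :
  measurable_fun setT U -> measurable_fun setT V ->
  {ae P, forall w, U w = V w} -> 'E_P[U] = 'E_P[V].
Proof.
move=> mU mV UV; rewrite unlock; apply: ae_eq_integral => //.
- exact/measurable_EFinP.
- exact/measurable_EFinP.
- by apply: filterS UV => w -> _.
Qed.

Lemma ae_eq_variance (U V : T -> R) :
  measurable_fun setT U -> measurable_fun setT V ->
  {ae P, forall w, U w = V w} -> 'V_P[U] = 'V_P[V].
Proof.
move=> mU mV UV.
rewrite /variance covariance.unlock (ae_eq_expectation mU mV UV).
apply: ae_eq_expectation.
- by apply: measurable_funM; exact: measurable_funB.
- by apply: measurable_funM; exact: measurable_funB.
- by apply: filterS UV => w /= UVw; rewrite /GRing.mul/= UVw.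
Qed.

Lemma variance_eq0 (U : T -> R) : U \in Lfun P 1 -> 'V_P[U] = 0 ->
  {ae P, forall w, (U w)%:E = 'E_P[U]}.
Proof.
move=> U1.
have /integrableP[/measurable_EFinP mU _] := (Lfun1_integrable P U).1 U1.
rewrite /variance covariance.unlock; set c := fine 'E_P[U] => V0.
rewrite expectation.unlock in V0.
have mq : measurable_fun setT (EFin \o ((U \- cst c) * (U \- cst c))%R).
  by apply/measurable_EFinP/measurable_funM; exact: measurable_funB.
have := (ae_eq_integral_abs P measurableT mq).1.
have -> : \int[P]_w `|(EFin \o ((U \- cst c) * (U \- cst c))%R) w| = 0.
  rewrite -[RHS]V0; apply: eq_integral => w _ /=.
  by rewrite ger0_norm// -expr2 sqr_ge0.
move=> /(_ erefl); apply: filterS => w /(_ I) /=.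
move=> [] /eqP; rewrite mulf_eq0 orbb subr_eq0 => /eqP ->.
by rewrite /c fineK ?expectation_fin_num.
Qed.

End square_integrable.

(** * The covariance of a Markov product *)

Section markov_product_covariance.
Context d d' (T : measurableType d) (S : measurableType d') (R : realType).
Variables (P : probability T R) (X : {RV P >-> S}).

Lemma is_cond_expectationB (Y1 Y2 Z1 Z2 : T -> R) :
  P.-integrable setT (EFin \o Y1) -> P.-integrable setT (EFin \o Y2) ->
  is_cond_expectation X Y1 Z1 -> is_cond_expectation X Y2 Z2 ->
  is_cond_expectation X (Y1 - Y2)%R (Z1 - Z2)%R.
Proof.
move=> iY1 iY2 [mZ1 iZ1 ZE1] [mZ2 iZ2 ZE2]; split.
- exact: measurable_funB.
- by have := integrableB measurableT iZ1 iZ2.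
- move=> A GA.
  have mA : measurable A.
    by case: GA => B mB <-; rewrite setTI; exact: measurable_funPTI.
  have iA f : P.-integrable setT f -> P.-integrable A f.
    by apply: integrableS.
  rewrite [LHS](integralB_EFin mA (iA _ iZ1) (iA _ iZ2)).
  by rewrite [RHS](integralB_EFin mA (iA _ iY1) (iA _ iY2)) ZE1 ?ZE2.
Qed.

Lemma cond_expectation_expectation (Y Z : T -> R) :
  is_cond_expectation X Y Z -> 'E_P[Z] = 'E_P[Y].
Proof.
move=> [_ _ ZE]; rewrite unlock; apply: ZE.
by exists setT => //; rewrite preimage_setT setTI.
Qed.

Lemma measurable_cond_expectation (Y Z : T -> R) :
  is_cond_expectation X Y Z -> measurable_fun setT Z.
Proof. by move=> [_ /measurable_int/measurable_EFinP]. Qed.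

Variables (Y Y' : {RV P >-> R}) (k : R.-pker S ~> R).
Hypotheses (kY : is_cond_distribution X Y k).
Hypotheses (kY' : is_cond_distribution X Y' k).
Hypothesis YY' : cond_independent X Y Y'.
Hypothesis Y2 : (Y : T -> R) \in Lfun P 2%:E.

Let Pfin : P setT \is a fin_num := fin_num_measure P _ measurableT.

(** The second moments of Y and of Y' are both the mean of the integral of
    y^2 against k(X). *)
Lemma Lfun2_cond_copy : (Y' : T -> R) \in Lfun P 2%:E.
Proof.
apply: Lfun2_sqr => //.
have mq : measurable_fun setT (fun y : R => (y ^+ 2)%:E).
  by apply/measurable_EFinP; exact: measurable_funX.
have q0 (y : R) : 0 <= (y ^+ 2)%:E by rewrite lee_fin sqr_ge0.
have := integral_cond_distribution kY' measurableT mq q0.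
rewrite -(integral_cond_distribution kY measurableT mq q0) preimage_setT => ->.
exact: integrable_lty (Lfun2_integrable_sqr Y2).
Qed.

(** The real-valued form of [ge0_expectation_cond_independent]: both inner
    integrals are almost surely finite, as f(Y) and g(Y) are integrable. *)
Lemma expectation_mul_kmean (f g : R -> R) :
  measurable_fun setT f -> measurable_fun setT g ->
  (forall y, 0 <= f y)%R -> (forall y, 0 <= g y)%R ->
  f \o Y \in Lfun P 2%:E -> g \o Y \in Lfun P 2%:E ->
  'E_P[(f \o Y) * (g \o Y')] = 'E_P[(kmean k f \o X) * (kmean k g \o X)].
Proof.
move=> mf mg f0 g0 fY2 gY2; rewrite unlock.
have ifY := (Lfun1_integrable P _).1 (Lfun_subset12 Pfin fY2).
have igY := (Lfun1_integrable P _).1 (Lfun_subset12 Pfin gY2).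
transitivity (\int[P]_w ((f (Y w))%:E * (g (Y' w))%:E)).
  by apply: eq_integral.
rewrite (ge0_expectation_cond_independent (f := EFin \o f) (g := EFin \o g)
  kY kY' YY')//; try exact/measurable_EFinP.
apply: ae_eq_integral => //.
- by apply: emeasurable_funM;
    apply: (measurableT_comp (measurable_kernel_integral _ _ _)).
- apply/measurable_EFinP/measurable_funM;
    by apply: (measurableT_comp (measurable_kmean _ _ _)).
- apply: filterS2 (EFin_kmean_ae kY mf f0 ifY) (EFin_kmean_ae kY mg g0 igY).
  by move=> w <- <- _.
Qed.

(** By [expectation_mul_kmean] with g = f, the second moment of the conditional
    mean is E(f(Y) f(Y')), which is finite by the Cauchy-Schwarz inequality. *)
Lemma Lfun2_kmean (f : R -> R) :
  measurable_fun setT f -> (forall y, 0 <= f y)%R ->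
  f \o Y \in Lfun P 2%:E -> f \o Y' \in Lfun P 2%:E ->
  kmean k f \o X \in Lfun P 2%:E.
Proof.
move=> mf f0 fY2 fY'2; apply: Lfun2_sqr.
  by apply: (measurableT_comp (measurable_kmean _ _ _)).
have := expectation_mul_kmean mf mf f0 f0 fY2 fY2.
have := expectation_fin_num (Lfun2_mul_Lfun1 fY2 fY'2).
by move=> /fin_numPlt/andP[_ +] E; rewrite E unlock.
Qed.

Lemma ge0_covariance_kmean (f g : R -> R) :
  measurable_fun setT f -> measurable_fun setT g ->
  (forall y, 0 <= f y)%R -> (forall y, 0 <= g y)%R ->
  f \o Y \in Lfun P 2%:E -> f \o Y' \in Lfun P 2%:E ->
  g \o Y \in Lfun P 2%:E -> g \o Y' \in Lfun P 2%:E ->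
  covariance P (f \o Y) (g \o Y') =
  covariance P (kmean k f \o X) (kmean k g \o X).
Proof.
move=> mf mg f0 g0 fY2 fY'2 gY2 gY'2.
have Af2 := Lfun2_kmean mf f0 fY2 fY'2.
have Ag2 := Lfun2_kmean mg g0 gY2 gY'2.
have L1 h : h \in Lfun P 2%:E -> h \in Lfun P 1 by exact: Lfun_subset12.
rewrite !covarianceE; do ?[exact: Lfun2_mul_Lfun1|exact: L1].
rewrite expectation_mul_kmean//; congr (_ - _ * _).
- apply/esym/cond_expectation_expectation/is_cond_expectation_kmean => //.
  exact/Lfun1_integrable/L1.
- apply/esym/cond_expectation_expectation/is_cond_expectation_kmean => //.
  exact/Lfun1_integrable/L1.
Qed.

(** Y is split into its positive part f(Y) and its negative part g(Y), and Y'
    likewise. The difference of the two conditional means is a version of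
    E(Y|X), and the four covariances match by [ge0_covariance_kmean]. *)
Lemma covariance_cond_copy :
  cond_expectation X Y \in Lfun P 2%:E /\
  covariance P Y Y' = 'V_P[cond_expectation X Y].
Proof.
pose f : R -> R := ((@id R)^\+)%R; pose g : R -> R := ((@id R)^\-)%R.
have mf : measurable_fun setT f by exact: measurable_funrpos.
have mg : measurable_fun setT g by exact: measurable_funrneg.
have f0 y : (0 <= f y)%R by exact: funrpos_ge0.
have g0 y : (0 <= g y)%R by exact: funrneg_ge0.
have fgK (W : T -> R) : W = ((f \o W) \- (g \o W))%R.
  by apply/funext => w /=; rewrite -[LHS](congr1 (@^~ (W w)) (funrposBneg id)).
have fle y : (`|f y| <= `|y|)%R.
  by rewrite -[leRHS](congr1 (@^~ y) (funrposDneg id)) ger0_norm// lerDl.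
have gle y : (`|g y| <= `|y|)%R.
  by rewrite -[leRHS](congr1 (@^~ y) (funrposDneg id)) ger0_norm// lerDr.
have Y'2 := Lfun2_cond_copy.
have comp2 (h : R -> R) (W : {RV P >-> R}) : measurable_fun setT h ->
    (forall y, `|h y| <= `|y|)%R -> (W : T -> R) \in Lfun P 2%:E ->
    h \o W \in Lfun P 2%:E.
  move=> mh hle; apply: Lfun2_le; first exact: measurableT_comp.
  by move=> w; exact: hle.
have fY := comp2 _ _ mf fle Y2; have gY := comp2 _ _ mg gle Y2.
have fY' := comp2 _ _ mf fle Y'2; have gY' := comp2 _ _ mg gle Y'2.
have Af := Lfun2_kmean mf f0 fY fY'; have Ag := Lfun2_kmean mg g0 gY gY'.
have L1 h : h \in Lfun P 2%:E -> P.-integrable setT (EFin \o h).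
  by move=> h2; exact/Lfun1_integrable/Lfun_subset12.
pose Z := ((kmean k f \o X) \- (kmean k g \o X))%R.
have ZE : is_cond_expectation X Y Z.
  rewrite [in X in is_cond_expectation _ X _](fgK Y).
  apply: is_cond_expectationB; [exact: L1|exact: L1| |].
  - by apply: is_cond_expectation_kmean => //; exact: L1.
  - by apply: is_cond_expectation_kmean => //; exact: L1.
have YE := cond_expectationP X (L1 _ Y2).
have mZ := measurable_cond_expectation ZE.
have mE := measurable_cond_expectation YE.
have aeE := cond_expectation_unique YE ZE.
have Z2 : Z \in Lfun P 2%:E by rewrite rpredB ?lee1n.
split.
  apply: Lfun2_sqr => //.
  apply: le_lt_trans (integrable_lty measurableT (Lfun2_integrable_sqr Z2)).
  rewrite le_eqVlt; apply/orP; left; apply/eqP.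
  apply: ae_eq_integral => //.
  - by apply/measurable_EFinP; exact: measurable_funX.
  - by apply/measurable_EFinP; exact: measurable_funX.
  - by apply: filterS aeE => w -> _.
rewrite (ae_eq_variance mE mZ aeE) /variance /Z.
rewrite [in LHS](fgK Y) [in LHS](fgK Y').
rewrite !covarianceBl ?covarianceBr ?rpredB ?lee1n//.
by rewrite !ge0_covariance_kmean.
Qed.

End markov_product_covariance.

Theorem corollary2p2 (R : realType) (d : measure_display) (T : measurableType d)
    (P : probability T R) (p : nat) (X : {RV P >-> p.-tuple R})
    (Y Y' : {RV P >-> R}) :
  (Y : T -> R) \in Lfun P 2%:E ->
  ~ degenerate P Y ->
  markov_product X Y Y' ->
  [<-> correlation_ratio X Y = 0;
       {ae P, forall w, (cond_expectation X Y w)%:E = 'E_P[Y]};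
       uncorrelated P Y Y'].
Proof.
move=> Y2 ndY YY'.
have [k [kY kY']] := markov_product_kernel YY'.
have [Z2 covE] := covariance_cond_copy kY kY' YY'.2 Y2.
have Pfin : P setT \is a fin_num by exact: fin_num_measure.
have Y1 := Lfun_subset12 Pfin Y2; have Z1 := Lfun_subset12 Pfin Z2.
have EYfin := expectation_fin_num Y1.
have ZE := cond_expectationP X ((Lfun1_integrable P Y).1 Y1).
rewrite /uncorrelated covE.
tfae.
- move=> R0.
  (* The inverse of the variance of Y vanishes only if the variance is
     infinite. *)
  have /(variance_eq0 Z1) : 'V_P[cond_expectation X Y] = 0.
    move: R0 => /eqP; rewrite /correlation_ratio mule_eq0 => /orP[/eqP//|].
    by rewrite inve_eq0 => /eqP VYy; have := variance_fin_num Y2; rewrite VYy.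
  by rewrite (cond_expectation_expectation ZE).
- move=> ZEY; rewrite -(variance_cst P (fine 'E_P[Y])).
  apply: ae_eq_variance => //; first exact: measurable_cond_expectation ZE.
  by apply: filterS ZEY => w ZEY; apply: EFin_inj; rewrite fineK.
- by move=> V0; rewrite /correlation_ratio V0 mul0e.
Qed.
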